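(* Let $n\ge 3$ and $a,b\ge 1$ be integers and let $C_n$ be the cycle with $n$ vertices. Let $f_1$ be the number of vertices of the legal complex of the weight game $W(a,b)$ played on $C_n$, i.e. the number of legal positions with exactly one piece. Then $$f_1=\begin{cases} 0 & \text{if } a,b>n,\\ n & \text{if either } a\le n \text{ or } b\le n \text{ but not both},\\ 2n & \text{if } a,b\le n.\end{cases}$$
   Context: The weight game $W(a,b)$ on a graph $B$ (the board) is the following two-player game. Starting with the empty board, Left places pieces of weight $a$ and Right places pieces of weight $b$; a piece of weight $w$ covers a connected set of $w$ distinct vertices, all of which must be empty when the piece is placed. Pieces are never moved or removed, and there are no further rules. Left and Right pieces are distinguishable by owner, even when $a=b$. A position is a set of pieces on the board. It is legal exactly when the pieces cover pairwise disjoint vertex sets; order of play is irrelevant, and moves need not alternate. On the cycle $C_n$, with vertices $\mathbb{Z}/n$ in clockwise order, a piece of weight $w\le n$ is specified by its owner and its left end $i\in\mathbb{Z}/n$ (the end in counter-clockwise direction), and covers the vertices $i,i+1,\dots,i+w-1$; pieces of the same owner with different left ends are counted as different placements (this matters only if $w=n$). The legal complex is the simplicial complex whose faces are the legal positions (vertices are the legal one-piece positions), and $f_i$ denotes the number of faces with $i$ vertices, i.e. of legal positions with exactly $i$ pieces. *)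

(* Defs.v *)
From HB Require Import structures.
From mathcomp Require Import all_boot.

Set Implicit Arguments.
Unset Strict Implicit.
Unset Printing Implicit Defensive.

Inductive player := Left | Right.

Definition bool_of_player (p : player) : bool := if p is Left then true else false.
Definition player_of_bool (b : bool) : player := if b then Left else Right.
Lemma bool_of_playerK : cancel bool_of_player player_of_bool.
Proof. by case. Qed.
HB.instance Definition _ := Finite.copy player (can_type bool_of_playerK).

Definition connected_set (T : finType) (e : rel T) (S : {set T}) : bool :=
  [forall x in S, forall y in S,
     connect [rel u v | [&& u \in S, v \in S & e u v]] x y].

(* A set of vertices that a piece of weight w may cover on the board (T, e). *)
Definition coverable (T : finType) (e : rel T) (w : nat) (S : {set T}) : bool :=
  connected_set e S && (#|S| == w).

(* Placements form an abstract type Pl, so that distinct placements may cover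
   the same set of vertices; this happens on the cycle when w = n. *)
Section LegalComplex.
Variables (T Pl : finType) (e : rel T) (wt : Pl -> nat) (cover : Pl -> {set T}).

Definition legal (X : {set Pl}) : bool :=
  [forall p in X, coverable e (wt p) (cover p)] &&
  [forall p in X, forall q in X, (p != q) ==> [disjoint cover p & cover q]].

Definition legal_complex : {set {set Pl}} := [set X | legal X].

Lemma legal_complex_down_closed (X Y : {set Pl}) :
  Y \subset X -> X \in legal_complex -> Y \in legal_complex.
Proof.
move=> /subsetP sYX; rewrite !inE => /andP[/forall_inP cX /forall_inP dX].
apply/andP; split; apply/forall_inP => p /sYX Xp; first exact: cX.
by apply/forall_inP => q /sYX; apply: (forall_inP (dX p Xp)).
Qed.

End LegalComplex.

(* f_i counts the faces with i vertices (of dimension i - 1). *)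
Definition face_number (Pl : finType) (K : {set {set Pl}}) (i : nat) : nat :=
  #|[set X in K | #|X| == i]|.

(* For n >= 3; ordS is the successor modulo n. *)
Definition cycle_graph (n : nat) : rel 'I_n :=
  [rel x y | (ordS x == y) || (ordS y == x)].

(* The vertices i, i + 1, ..., i + w - 1 modulo n. *)
Definition arc (n : nat) (i : 'I_n) (w : nat) : {set 'I_n} :=
  [set iter k (@ordS n) i | k : 'I_w].

(* Owner and left end.  No bound on the weight is built in: for w > n the arc
   has n < w vertices, so it is not coverable by a piece of weight w. *)
Definition cycle_placement (n : nat) : finType := (player * 'I_n)%type.

Definition weight (a b : nat) (p : player) : nat := if p is Left then a else b.

Definition cycle_legal_complex (n a b : nat) : {set {set cycle_placement n}} :=
  legal_complex (@cycle_graph n)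
    (fun p : cycle_placement n => weight a b p.1)
    (fun p : cycle_placement n => arc p.2 (weight a b p.1)).

(* Main.v *)
Require Import Defs.
From mathcomp Require Import all_boot.

(** A one-piece position is legal exactly when its piece is coverable, since disjointness concerns
    distinct pieces only; so [f_1] counts coverable placements ([face_number1]). An arc on the cycle
    is always connected, and it has [w] vertices exactly when [w <= n] ([coverable_arc]). Hence each
    owner whose weight is at most [n] contributes all [n] left ends and any other owner none, giving
    [((a <= n) + (b <= n)) * n], from which the three cases are read off. *)

Lemma val_iter_ordS n k (i : 'I_n) : val (iter k (@ordS n) i) = (i + k) %% n.
Proof.
elim: k => [|k IHk] /=; first by rewrite addn0 modn_small.
by rewrite IHk -addn1 modnDml addn1 addnS.
Qed.

(** Offsets below [w <= n] are their own residues modulo [n], so distinct offsets from [i] reach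
    distinct vertices. *)
Lemma card_arc n (i : 'I_n) w : w <= n -> #|Defs.arc i w| = w.
Proof.
move=> le_wn; rewrite card_imset ?card_ord // => k l /(congr1 val).
rewrite !val_iter_ordS => /eqP; rewrite eqn_modDl => /eqP.
by rewrite !modn_small ?(leq_trans (ltn_ord _)) // => /val_inj.
Qed.

(** Walking clockwise from the left end [i] reaches every vertex of the arc without leaving it; by
    symmetry any two vertices are joined through [i]. This holds even when the arc wraps around. *)
Lemma connected_arc n (i : 'I_n) w :
  connected_set (@cycle_graph n) (Defs.arc i w).
Proof.
set e := [rel u v |
  [&& u \in Defs.arc i w, v \in Defs.arc i w & cycle_graph u v]].
have arcP k : k < w -> iter k (@ordS n) i \in Defs.arc i w.
  by move=> lt_kw; apply/imsetP; exists (Ordinal lt_kw).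
have from_end k : k < w -> connect e i (iter k (@ordS n) i).
  elim: k => [|k IHk] lt_kw; first exact: connect0.
  apply: connect_trans (IHk (ltnW lt_kw)) (connect1 _).
  apply/and3P; split; [exact/arcP/ltnW | exact: arcP |].
  by rewrite /cycle_graph /= eqxx.
have e_sym : connect_sym e.
  by apply: sym_connect_sym => x y; rewrite /e /cycle_graph /= andbCA orbC.
apply/forall_inP=> _ /imsetP[k _ ->]; apply/forall_inP=> _ /imsetP[l _ ->].
apply: (@connect_trans _ _ i); last exact: from_end.
by rewrite e_sym; apply: from_end.
Qed.

Lemma coverable_arc n (i : 'I_n) w :
  coverable (@cycle_graph n) w (Defs.arc i w) = (w <= n).
Proof.
rewrite /coverable connected_arc /=; apply/eqP/idP => [<-|]; last exact: card_arc.
(* An arc with [w] vertices lies in a board of [n] vertices. *)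
by rewrite -[leqRHS]card_ord max_card.
Qed.

Lemma legal_set1 (T Pl : finType) (e : rel T) (wt : Pl -> nat)
    (cover : Pl -> {set T}) p :
  legal e wt cover [set p] = coverable e (wt p) (cover p).
Proof.
apply/andP/idP => [[/forall_inP/(_ p (set11 p))] // | cov_p].
split; first by apply/forall_inP => q /set1P->.
by apply/forall_inP => q /set1P->; apply/forall_inP => r /set1P->; rewrite eqxx.
Qed.

(** The injection [p] to [[set p]] matches coverable placements with one-element faces. *)
Lemma face_number1 (T Pl : finType) (e : rel T) (wt : Pl -> nat)
    (cover : Pl -> {set T}) :
  face_number (legal_complex e wt cover) 1 =
    #|[set p | coverable e (wt p) (cover p)]|.
Proof.
rewrite -(card_imset _ (@set1_inj Pl)); apply: eq_card => X.
rewrite !inE; apply/andP/imsetP => [[legX /cards1P[p defX]] | [p]].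
  by exists p; rewrite // inE -legal_set1 -defX.
by rewrite inE => cov_p ->; rewrite legal_set1 cards1.
Qed.

Lemma face_number1_cycle n a b :
  face_number (cycle_legal_complex n a b) 1 = ((a <= n) + (b <= n)) * n.
Proof.
rewrite face_number1.
have -> : [set p : cycle_placement n |
            coverable (@cycle_graph n) (weight a b p.1)
              (Defs.arc p.2 (weight a b p.1))]
          = setX [set o | weight a b o <= n] [set: 'I_n].
  by apply/setP => p; rewrite !inE coverable_arc andbT.
rewrite cardsX cardsT card_ord; congr (_ * n).
(* The number of owners with a small enough weight becomes a sum of indicators over [Left] and
   [Right]; the remaining sum is empty. *)
rewrite -sum1dep_card big_mkcond (bigD1 Left) //= (bigD1 Right) //=.
by rewrite big1 ?addn0; [do 2 case: ifP | case].
Qed.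

Theorem proposition5p1 (n a b : nat) (hn : 3 <= n) (ha : 1 <= a) (hb : 1 <= b) :
  [/\ n < a /\ n < b -> face_number (cycle_legal_complex n a b) 1 = 0,
      (a <= n /\ ~ b <= n) \/ (b <= n /\ ~ a <= n) ->
        face_number (cycle_legal_complex n a b) 1 = n
    & a <= n /\ b <= n -> face_number (cycle_legal_complex n a b) 1 = 2 * n].
Proof.
rewrite face_number1_cycle; split.
- by rewrite !ltnNge => -[/negPf-> /negPf->].
- by case=> -[-> /negP/negPf->]; rewrite mul1n.
- by case=> -> ->.
Qed.
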